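(* Suppose that $\kappa = \nu^+$, $J$ is a $\kappa$-complete ideal on $\kappa$ such that $\clubsuit_\kappa^{{\rm cof}, -}[J]$ holds, and $\tau$ is a regular cardinal less than $Depth({}^\kappa\kappa)$. Then there exists either an ascending $(J, I_\kappa)$-tower of length $\tau$, or a descending $(J, J)$-tower of length $\tau$.
   Context: An ideal on $\kappa$ is a nonempty $J \subseteq P(\kappa)$ with $\kappa \notin J$, every bounded subset of $\kappa$ in $J$, $J$ closed under subsets and under unions of two members; $J^+ = P(\kappa)\setminus J$; $\kappa$-complete means closed under unions of fewer than $\kappa$ members. $I_\kappa$ is the ideal of bounded subsets of $\kappa$. For a set $A$ and cardinal $\rho$, $P_\rho(A) = \{a \subseteq A : |a| < \rho\}$, and $[\kappa]^\kappa$ is the set of size-$\kappa$ subsets of $\kappa$. $\clubsuit_\kappa^{{\rm cof}, -}[J]$ asserts the existence of $B^i_\delta \in P_{|\delta|}(\delta)$ for $i < \delta < \kappa$ such that for any $W \in [\kappa]^\kappa$, $\{\delta < \kappa : \exists i < \delta\, (\sup(W \cap B^i_\delta) = \delta)\} \in J^+$. For $f, g \in {}^\kappa\kappa$, $f <^* g$ means $|\{\alpha < \kappa : f(\alpha) \geq g(\alpha)\}| < \kappa$; $Depth({}^\kappa\kappa)$ is the least ordinal $\eta$ such that there is no $<^*$-increasing sequence $\langle f_i : i < \eta\rangle$ in ${}^\kappa\kappa$. For $Y \subseteq P(\kappa)$ and an ordinal $\delta$, a descending (respectively, ascending) $(J,Y)$-tower of length $\delta$ is a sequence $\langle A_\alpha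 : \alpha < \delta\rangle$ with each $A_\alpha \in J^+$ such that whenever $\alpha < \beta < \delta$: $A_\beta \setminus A_\alpha \in Y$ and $A_\alpha \setminus A_\beta \in J^+$ (respectively, $A_\alpha \setminus A_\beta \in Y$ and $A_\beta \setminus A_\alpha \in J^+$). *)

(* Defs.v *)
(* Ordinals / cardinals are modelled by well-ordered types:
   a cardinal kappa is a type K with a strict well-order ltK whose proper
   initial segments all have strictly smaller cardinality (an initial ordinal);
   an ordinal delta < kappa is an element d : K, identified with the set
   {x | ltK x d} of its predecessors.  Subsets of kappa are predicates K -> Prop. *)

Definition le_card (A B : Type) : Prop :=
  exists f : A -> B, forall x y, f x = f y -> x = y.
Definition lt_card (A B : Type) : Prop := le_card A B /\ ~ le_card B A.

Definition strict_well_order {X : Type} (lt : X -> X -> Prop) : Prop :=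
  (forall x, ~ lt x x) /\
  (forall x y z, lt x y -> lt y z -> lt x z) /\
  (forall x y, lt x y \/ x = y \/ lt y x) /\
  well_founded lt.

Definition seg {X : Type} (lt : X -> X -> Prop) (t : X) : Type := {x : X | lt x t}.

Definition is_inf_cardinal {X : Type} (lt : X -> X -> Prop) : Prop :=
  strict_well_order lt /\ le_card nat X /\ forall t : X, lt_card (seg lt t) X.

Definition is_successor_cardinal {K : Type} (ltK : K -> K -> Prop) : Prop :=
  strict_well_order ltK /\
  exists N : Type, le_card nat N /\ lt_card N K /\
    forall k : K, le_card (seg ltK k) N.

Definition is_regular_cardinal {T : Type} (ltT : T -> T -> Prop) : Prop :=
  is_inf_cardinal ltT /\
  forall C : T -> Prop, (forall t, exists c, C c /\ ~ ltT c t) ->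
    le_card T {x : T | C x}.

Section Sets.
Context {K : Type} (ltK : K -> K -> Prop).

Definition subset (A B : K -> Prop) : Prop := forall x, A x -> B x.
Definition setU (A B : K -> Prop) : K -> Prop := fun x => A x \/ B x.
Definition setD (A B : K -> Prop) : K -> Prop := fun x => A x /\ ~ B x.
Definition setI (A B : K -> Prop) : K -> Prop := fun x => A x /\ B x.

Definition bounded (A : K -> Prop) : Prop := exists b, forall x, A x -> ltK x b.

Definition I_kappa : (K -> Prop) -> Prop := bounded.

Definition is_ideal (J : (K -> Prop) -> Prop) : Prop :=
  (exists A, J A) /\
  ~ J (fun _ => True) /\
  (forall A, bounded A -> J A) /\
  (forall A B, J B -> subset A B -> J A) /\
  (forall A B, J A -> J B -> J (setU A B)).

Definition kappa_complete (J : (K -> Prop) -> Prop) : Prop :=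
  forall (I : Type) (F : I -> K -> Prop), lt_card I K ->
    (forall i, J (F i)) -> J (fun x => exists i, F i x).

Definition Jplus (J : (K -> Prop) -> Prop) (A : K -> Prop) : Prop := ~ J A.

(* sup X = delta, for X a subset of delta (delta > 0):  X is unbounded in delta *)
Definition sup_eq (X : K -> Prop) (d : K) : Prop :=
  forall g, ltK g d -> exists b, X b /\ ltK g b.

Definition clubsuit_cof_minus (J : (K -> Prop) -> Prop) : Prop :=
  exists B : K -> K -> K -> Prop,
    (forall d i, ltK i d ->
       subset (B d i) (fun x => ltK x d) /\
       lt_card {x : K | B d i x} (seg ltK d)) /\
    (forall W : K -> Prop, le_card K {x : K | W x} ->
       Jplus J (fun d => exists i, ltK i d /\ sup_eq (setI W (B d i)) d)).

Definition lt_star (f g : K -> K) : Prop :=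
  lt_card {a : K | ~ ltK (f a) (g a)} K.

Definition has_increasing_seq {E : Type} (ltE : E -> E -> Prop) : Prop :=
  exists F : E -> K -> K, forall a b, ltE a b -> lt_star (F a) (F b).

(* tau < Depth(^kappa kappa), tau given by (T, ltT): since Depth is the least
   eta with no <*-increasing sequence of length eta, this says that for every
   ordinal eta <= tau there is such a sequence of length eta. *)
Definition lt_Depth {T : Type} (ltT : T -> T -> Prop) : Prop :=
  has_increasing_seq ltT /\
  forall t : T, has_increasing_seq (fun x y : seg ltT t => ltT (proj1_sig x) (proj1_sig y)).

Definition descending_tower (J Y : (K -> Prop) -> Prop)
  {T : Type} (ltT : T -> T -> Prop) (A : T -> K -> Prop) : Prop :=
  (forall a, Jplus J (A a)) /\
  forall a b, ltT a b -> Y (setD (A b) (A a)) /\ Jplus J (setD (A a) (A b)).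

Definition ascending_tower (J Y : (K -> Prop) -> Prop)
  {T : Type} (ltT : T -> T -> Prop) (A : T -> K -> Prop) : Prop :=
  (forall a, Jplus J (A a)) /\
  forall a b, ltT a b -> Y (setD (A a) (A b)) /\ Jplus J (setD (A b) (A a)).

End Sets.

(* Main.v *)
(* Let [R_t], [t < tau], be the sets of codes of the points below the graph of
   the [t]-th function of the given sequence: they increase modulo bounded sets,
   with differences of size [kappa].  Let [A n a b] be the set of [delta] such
   that [R_b \ R_a] meets the [n]-th set [B] attached to [delta] cofinally in
   [delta], where [n < nu] through an enumeration of [delta].
   It increases with [b] modulo bounded sets; if there is no ascending tower it
   is constant modulo [J] from some [b = eta(a)] on, and then
   [Q n a := A n a (eta a)] decreases with [a] modulo [J].  If there is no
   descending tower, [Q n a] is constant modulo [J] from some [a1] on, for all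
   [n] at once.  Pick [nu] many indices [a] spaced so that the sets
   [R_(eta a) \ R_a] are almost disjoint; by [kappa]-completeness some [delta]
   lies in all the corresponding [Q n a], and then a single [B] of size less
   than [nu] meets [nu] almost disjoint sets cofinally, which is absurd.
   This needs [tau > kappa]; for [tau <= kappa] the unions of an Ulam family of
   disjoint positive sets form an ascending tower.  The same family provides the
   coding of pairs. *)

From Stdlib Require Import Classical IndefiniteDescription FunctionalExtensionality.
Require Import Defs.

(** * Comparison of cardinalities by injections *)

Lemma proj1_sig_inj {A : Type} (P : A -> Prop) (s t : {x | P x}) :
  proj1_sig s = proj1_sig t -> s = t.
Proof.
  destruct s as [x hx], t as [y hy]; simpl. intros E. subst y.
  now rewrite (proof_irrelevance _ hx hy).
Qed.

Lemma le_card_trans (A B C : Type) : le_card A B -> le_card B C -> le_card A C.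
Proof.
  intros [f Hf] [g Hg]. exists (fun x => g (f x)). auto.
Qed.

Lemma not_le_lt_card (K : Type) (A : K -> Prop) :
  ~ le_card K {x | A x} -> lt_card {x | A x} K.
Proof.
  intros H. split; [|exact H].
  exists (@proj1_sig _ _). apply proj1_sig_inj.
Qed.

Lemma le_lt_card_trans (A B C : Type) : le_card A B -> lt_card B C -> lt_card A C.
Proof.
  intros H [H1 H2]. split.
  - exact (le_card_trans _ _ _ H H1).
  - intros H3. apply H2. exact (le_card_trans _ _ _ H3 H).
Qed.

Lemma le_card_image (I X : Type) (F : I -> X) : le_card {x | exists i, x = F i} I.
Proof.
  destruct (functional_choice (fun (s : {x | exists i, x = F i}) i => proj1_sig s = F i))
    as [h Hh].
  { intros [x hx]. exact hx. }
  exists h. intros s t E. apply proj1_sig_inj. rewrite (Hh s), (Hh t). now f_equal.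
Qed.

(** Hilbert's hotel: shifting the copy of [nat] given by [u] one step frees [u 0] for [None]. *)
Lemma le_card_option (N : Type) : le_card nat N -> le_card (option N) N.
Proof.
  intros [u Hu].
  destruct (functional_choice
    (fun n m => (exists k, n = u k /\ m = u (S k)) \/ ((forall k, n <> u k) /\ m = n)))
    as [s Hs].
  { intros n. destruct (classic (exists k, n = u k)) as [[k Hk]|H].
    - exists (u (S k)). left. eauto.
    - exists n. right. split; [|reflexivity]. intros k Hk. apply H. eauto. }
  exists (fun o => match o with Some n => s n | None => u 0 end).
  assert (H0 : forall n, s n <> u 0).
  { intros n E. destruct (Hs n) as [[k [_ Hk]]|[Hk Hk']].
    - rewrite E in Hk. apply Hu in Hk. discriminate.
    - apply (Hk 0). congruence. }
  intros [n|] [m|] E.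
  - f_equal. destruct (Hs n) as [[k [Hk Hk']]|[Hk Hk']];
      destruct (Hs m) as [[l [Hl Hl']]|[Hl Hl']].
    + assert (S k = S l) by (apply Hu; congruence). congruence.
    + exfalso. apply (Hl (S k)). congruence.
    + exfalso. apply (Hk (S l)). congruence.
    + congruence.
  - exfalso. exact (H0 _ E).
  - exfalso. exact (H0 _ (eq_sym E)).
  - reflexivity.
Qed.

(** * Sparse sequences by transfinite recursion *)

Section Thinning.

Context {X T : Type} (ltX : X -> X -> Prop) (ltT : T -> T -> Prop).

(** The value at [b] is chosen above [nx (g a)] for all [a] before [b], by well-founded recursion on
    [ltX]. *)
Lemma thin (nx : T -> T) :
  well_founded ltX ->
  (forall x (F : seg ltX x -> T), exists t, forall s, ltT (F s) t) ->
  exists g : X -> T, forall a b, ltX a b -> ltT (nx (g a)) (g b).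
Proof.
  intros wf H.
  destruct (functional_choice
    (fun (p : {x : X & seg ltX x -> T}) t => forall s, ltT (projT2 p s) t)) as [bd Hbd].
  { intros [x F]. apply H. }
  pose (step := fun (b : X) (rec : forall y, ltX y b -> T) =>
    bd (existT _ b (fun s : seg ltX b => nx (rec (proj1_sig s) (proj2_sig s))))).
  exists (Fix wf (fun _ => T) step). intros a b Hab.
  rewrite (Fix_eq wf (fun _ => T) step) with (x := b).
  - unfold step at 2.
    exact (Hbd (existT _ b (fun s : seg ltX b => nx (Fix wf (fun _ => T) step (proj1_sig s))))
             (exist _ a Hab)).
  - intros x f g E. f_equal.
    apply functional_extensionality_dep; intros y.
    apply functional_extensionality_dep; intros h. apply E.
Qed.

End Thinning.

(** * Bounds in a regular cardinal *)

Section Regular.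

Context {T : Type} (ltT : T -> T -> Prop) (Treg : is_regular_cardinal ltT).

(** An unbounded range would be cofinal, hence of full size by regularity, yet it injects into
    [I]. *)
Lemma regular_bounded_family (I : Type) (F : I -> T) :
  ~ le_card T I -> exists t, forall i, ltT (F i) t.
Proof.
  intros HI. apply NNPP; intros H. apply HI.
  refine (le_card_trans _ _ _ (proj2 Treg (fun x => exists i, x = F i) _)
            (le_card_image I T F)).
  intros t. apply NNPP; intros H'. apply H. exists t. intros i.
  apply NNPP; intros H''. apply H'. exists (F i). split; [now exists i|exact H''].
Qed.

Lemma regular_upper_bound (a b : T) : exists c, ltT a c /\ ltT b c.
Proof.
  destruct (regular_bounded_family bool (fun c : bool => if c then a else b)) as [c Hc].
  - intros H. destruct Treg as [[_ [H0 _]] _].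
    destruct (le_card_trans _ _ _ H0 H) as [f Hf].
    assert (D : f 0 = f 1 \/ f 0 = f 2 \/ f 1 = f 2).
    { destruct (f 0), (f 1), (f 2); auto. }
    destruct D as [D|[D|D]]; apply Hf in D; discriminate.
  - exists c. exact (conj (Hc true) (Hc false)).
Qed.

Lemma regular_thin (nx : T -> T) :
  exists g : T -> T, forall a b, ltT a b -> ltT (nx (g a)) (g b).
Proof.
  destruct Treg as [[[_ [_ [_ wf]]] [_ Hs]] _].
  apply thin; [exact wf|].
  intros x F. apply regular_bounded_family. exact (proj2 (Hs x)).
Qed.

End Regular.

(** * Towers extracted from sequences monotone modulo an ideal *)

Section Ideal.

Context {K : Type} (ltK : K -> K -> Prop) (J : (K -> Prop) -> Prop).
Context (Kord : strict_well_order ltK) (Jid : is_ideal ltK J) (Jcomp : kappa_complete J).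

Lemma ideal_sub (A B : K -> Prop) : J B -> subset A B -> J A.
Proof. destruct Jid as [_ [_ [_ [H _]]]]. eauto. Qed.

Lemma ideal_setU (A B : K -> Prop) : J A -> J B -> J (setU A B).
Proof. destruct Jid as [_ [_ [_ [_ H]]]]. auto. Qed.

Lemma ideal_bounded (A : K -> Prop) : bounded ltK A -> J A.
Proof. destruct Jid as [_ [_ [H _]]]. auto. Qed.

Lemma ideal_proper : ~ J (fun _ => True).
Proof. exact (proj1 (proj2 Jid)). Qed.

Lemma ideal_setD_trans (A B C : K -> Prop) :
  J (setD A B) -> J (setD B C) -> J (setD A C).
Proof.
  intros H1 H2. apply (ideal_sub _ _ (ideal_setU _ _ H1 H2)).
  intros x [Ha Hc]. destruct (classic (B x)); [right|left]; now split.
Qed.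

Context {T : Type} (ltT : T -> T -> Prop) (Treg : is_regular_cardinal ltT).

(** Without a stable index, every [a] has a later [nx a] at which [P] has grown by a positive set;
    thinning out so that these growth intervals follow one another gives the tower. *)
Lemma ascending_or_stable (P : T -> K -> Prop) :
  (forall a b, ltT a b -> bounded ltK (setD (P a) (P b))) ->
  (exists A, ascending_tower J (I_kappa ltK) ltT A) \/
  exists a, forall b, ltT a b -> J (setD (P b) (P a)).
Proof.
  intros mono. destruct (classic (exists a, forall b, ltT a b -> J (setD (P b) (P a))))
    as [H|H]; [now right|left].
  destruct (functional_choice (fun a b => ltT a b /\ ~ J (setD (P b) (P a)))) as [nx Hnx].
  { intros a. apply NNPP; intros H1. apply H. exists a. intros b Hab.
    apply NNPP; intros H2. apply H1. eauto. }
  destruct (regular_thin ltT Treg nx) as [g Hg].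
  destruct Treg as [[[_ [trans _]] _] _].
  (* The upper end [nx (g b)] of each interval is used: its set is positive because it contains the
     growth over [P (g b)]. *)
  exists (fun b => P (nx (g b))). split.
  - intros a H1. apply (proj2 (Hnx (g a))). apply (ideal_sub _ _ H1). now intros x [].
  - intros a b Hab. split.
    + apply mono. apply trans with (g b); [now apply Hg|apply Hnx].
    + intros H1. apply (proj2 (Hnx (g b))). apply (ideal_setD_trans _ _ _ H1).
      apply ideal_bounded, mono, Hg, Hab.
Qed.

Lemma descending_or_stable (P : T -> K -> Prop) :
  (forall a b, ltT a b -> J (setD (P b) (P a))) ->
  (exists A, descending_tower J J ltT A) \/
  exists a, forall b, ltT a b -> J (setD (P a) (P b)).
Proof.
  intros mono. destruct (classic (exists a, forall b, ltT a b -> J (setD (P a) (P b))))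
    as [H|H]; [now right|left].
  destruct (functional_choice (fun a b => ltT a b /\ ~ J (setD (P a) (P b)))) as [nx Hnx].
  { intros a. apply NNPP; intros H1. apply H. exists a. intros b Hab.
    apply NNPP; intros H2. apply H1. eauto. }
  destruct (regular_thin ltT Treg nx) as [g Hg].
  destruct Treg as [[[_ [trans _]] _] _].
  (* Here the lower end serves, since [P (g b)] contains the positive part lost on the way to
     [nx (g b)]. *)
  exists (fun b => P (g b)). split.
  - intros a H1. apply (proj2 (Hnx (g a))). apply (ideal_sub _ _ H1). now intros x [].
  - intros a b Hab. split.
    + apply mono. apply trans with (nx (g a)); [apply Hnx|now apply Hg].
    + intros H1. apply (proj2 (Hnx (g a))). apply (ideal_setD_trans _ _ _ H1).
      apply mono, Hg, Hab.
Qed.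

Lemma ascending_tower_of_disjoint (V : K -> K -> Prop) :
  (exists k : K, True) ->
  (forall a, ~ J (V a)) -> (forall a b x, V a x -> V b x -> a = b) ->
  le_card T K -> exists A, ascending_tower J (I_kappa ltK) ltT A.
Proof.
  intros [k _] pos disj [j Hj].
  destruct Treg as [[[irr [trans _]] _] _].
  (* Unions over all [s] up to and including [t]: they truly increase, and stage [b] adds at least
     [V (j b)]. *)
  exists (fun t x => exists s, ~ ltT t s /\ V (j s) x). split.
  - intros a H. apply (pos (j a)). apply (ideal_sub _ _ H). intros x Hx. now exists a; auto.
  - intros a b Hab. split.
    + exists k. intros x [[s [Hs Hx]] Hn]. exfalso. apply Hn. exists s. split; [|exact Hx].
      intros H. apply Hs. eauto.
    + intros H. apply (pos (j b)). apply (ideal_sub _ _ H). intros x Hx. split.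
      * exists b; auto.
      * intros [s [Hs Hx']]. pose proof (Hj _ _ (disj _ _ _ Hx Hx')). subst s. auto.
Qed.

End Ideal.

(** * Complete ideals on a successor cardinal: regularity, Ulam families, coding of pairs *)

Section Successor.

Context {K : Type} (ltK : K -> K -> Prop) (J : (K -> Prop) -> Prop).
Context (Kord : strict_well_order ltK) (Jid : is_ideal ltK J) (Jcomp : kappa_complete J).
Context (N : Type) (Ninf : le_card nat N) (NK : lt_card N K).
Context (segN : forall k : K, le_card (seg ltK k) N).

Lemma lt_total_ge (x y : K) : ~ ltK x y -> x = y \/ ltK y x.
Proof.
  destruct Kord as [_ [_ [tot _]]]. destruct (tot x y) as [H|[H|H]]; tauto.
Qed.

(** With a maximum, [K] would be a segment plus one point, so would inject into [option N] and hence
    into [N]. *)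
Lemma succ_card_no_max (m : K) : exists y, ltK m y.
Proof.
  apply NNPP; intros H. apply (proj2 NK).
  apply (le_card_trans _ (option N)); [|now apply le_card_option].
  destruct (segN m) as [e He].
  destruct (functional_choice (fun x o => (x = m /\ o = None) \/
     exists h : ltK x m, o = Some (e (exist _ x h)))) as [f Hf].
  { intros x. destruct (lt_total_ge m x) as [E|E]; [|exists None; auto|].
    - intros H'. eauto.
    - eexists; right; exists E; reflexivity. }
  exists f. intros x y E.
  destruct (Hf x) as [[Ex Hx]|[h Hx]]; destruct (Hf y) as [[Ey Hy]|[h' Hy]]; try congruence.
  rewrite Hx, Hy in E. injection E as E. apply He in E. now injection E.
Qed.

Lemma le_N_lt_card (I : Type) : le_card I N -> lt_card I K.
Proof. intros H. exact (le_lt_card_trans _ _ _ H NK). Qed.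

(** Regularity of kappa comes from the ideal: if the family were unbounded, the segments up to each
    [F i] would cover [K], and completeness would put [K] in [J]. *)
Lemma bounded_family (I : Type) (F : I -> K) :
  lt_card I K -> exists b, forall i, ltK (F i) b.
Proof.
  intros HI. apply NNPP; intros H. apply (ideal_proper ltK J Jid).
  apply (ideal_sub ltK J Jid) with (fun x => exists i, ~ ltK (F i) x).
  - apply Jcomp; [exact HI|]. intros i. apply (ideal_bounded ltK J Jid).
    destruct (succ_card_no_max (F i)) as [y Hy]. exists y. intros x Hx.
    destruct (lt_total_ge _ _ Hx) as [<-|E]; [exact Hy|].
    destruct Kord as [_ [trans _]]. eauto.
  - intros x _. apply NNPP; intros H'. apply H. exists x. intros i.
    apply NNPP; intros H''. eauto.
Qed.

Lemma small_in_ideal (A : K -> Prop) : lt_card {x | A x} K -> J A.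
Proof.
  intros H. apply (ideal_bounded ltK J Jid).
  destruct (bounded_family _ (@proj1_sig _ A) H) as [b Hb].
  exists b. intros x Hx. exact (Hb (exist _ x Hx)).
Qed.

Lemma positive_full_card (A : K -> Prop) : ~ J A -> le_card K {x | A x}.
Proof.
  intros H. apply NNPP; intros H'. now apply H, small_in_ideal, not_le_lt_card.
Qed.

Lemma positive_union (I : Type) (F : I -> K -> Prop) :
  lt_card I K -> ~ J (fun x => exists i, F i x) -> exists i, ~ J (F i).
Proof.
  intros HI H. apply NNPP; intros H'. apply H. apply Jcomp; [exact HI|].
  intros i. apply NNPP; intros H''. eauto.
Qed.

Lemma enumerations : exists e : K -> K -> N,
  forall d i j, ltK i d -> ltK j d -> e d i = e d j -> i = j.
Proof.
  destruct Ninf as [u _].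
  destruct (functional_choice (fun (d : K) (f : K -> N) =>
    forall i j, ltK i d -> ltK j d -> f i = f j -> i = j)) as [e He]; [|now exists e].
  intros d. destruct (segN d) as [f Hf].
  destruct (functional_choice (fun (i : K) n => forall h : ltK i d, n = f (exist _ i h)))
    as [g Hg].
  { intros i. destruct (classic (ltK i d)) as [h|h].
    - exists (f (exist _ i h)). intros h'. now rewrite (proof_irrelevance _ h h').
    - exists (u 0). now intros h'. }
  exists g. intros i j hi hj E. rewrite (Hg i hi), (Hg j hj) in E.
  apply Hf in E. now injection E.
Qed.

(** Ulam matrix. For each [a], the sets of [b] above [a] with [e b a = n] cover a final segment, so
    one is positive, say for [n = c a]. Then [c] is constant on a set of size kappa, and sets in the
    same row [n] are disjoint because [e b] is injective below [b]. *)
Lemma ulam : exists V : K -> K -> Prop,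
  (forall a, ~ J (V a)) /\ forall a b x, V a x -> V b x -> a = b.
Proof.
  destruct enumerations as [e He].
  destruct (functional_choice
    (fun a n => ~ J (fun b => ltK a b /\ e b a = n))) as [c Hc].
  { intros a. apply (positive_union N (fun n b => ltK a b /\ e b a = n) NK).
    intros H. apply (ideal_proper ltK J Jid).
    destruct (succ_card_no_max a) as [y Hy].
    apply (ideal_sub ltK J Jid) with (2 := fun x _ => classic (ltK a x)).
    apply (ideal_setU ltK J Jid).
    - apply (ideal_sub ltK J Jid _ _ H). intros b Hb. now exists (e b a).
    - apply (ideal_bounded ltK J Jid). exists y. intros x Hx.
      destruct (lt_total_ge _ _ Hx) as [<-|E]; [exact Hy|].
      destruct Kord as [_ [trans _]]. eauto. }
  destruct (positive_union N (fun n a => c a = n) NK) as [n Hn].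
  { intros H. apply (ideal_proper ltK J Jid). apply (ideal_sub ltK J Jid _ _ H).
    intros a _. now exists (c a). }
  destruct (positive_full_card _ Hn) as [j Hj].
  exists (fun a b => ltK (proj1_sig (j a)) b /\ e b (proj1_sig (j a)) = n). split.
  - intros a. destruct (j a) as [y <-]; simpl. apply Hc.
  - intros a b x [H1 H2] [H3 H4]. apply Hj.
    assert (E : proj1_sig (j a) = proj1_sig (j b)).
    { apply (He x); congruence. }
    destruct (j a) as [y hy], (j b) as [z hz]; simpl in E. subst z.
    now rewrite (proof_irrelevance _ hy hz).
Qed.

(** The code of [(a, b)] lies in [V a], which has kappa many points; disjointness recovers [a]. *)
Lemma pairing : exists p : K -> K -> K,
  forall a b a' b', p a b = p a' b' -> a = a' /\ b = b'.
Proof.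
  destruct ulam as [V [pos disj]].
  destruct (functional_choice (fun a (f : K -> K) =>
    (forall b, V a (f b)) /\ forall b b', f b = f b' -> b = b')) as [p Hp].
  { intros a. destruct (positive_full_card _ (pos a)) as [f Hf].
    exists (fun b => proj1_sig (f b)). split.
    - intros b. exact (proj2_sig (f b)).
    - intros b b' E. now apply Hf, proj1_sig_inj. }
  exists p. intros a b a' b' E.
  assert (a = a').
  { apply (disj a a' (p a b)); [|rewrite E]; apply Hp. }
  subst a'. split; [reflexivity|]. now apply (Hp a).
Qed.

Lemma almost_increasing_sets {T : Type} (ltT : T -> T -> Prop) :
  has_increasing_seq ltK ltT ->
  exists R : T -> K -> Prop, forall a b, ltT a b ->
    bounded ltK (setD (R a) (R b)) /\ le_card K {x | setD (R b) (R a) x}.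
Proof.
  intros [F HF]. destruct pairing as [p Hp]. pose proof Kord as [irr [trans _]].
  exists (fun t x => exists al be, x = p al be /\ ltK be (F t al)).
  intros a b Hab. pose proof (HF a b Hab) as small. split.
  (* Only columns [al] where [F a al < F b al] fails contribute. There are fewer than kappa of them,
     and the codes in each are bounded. *)
  - destruct (functional_choice
      (fun al c => forall be, ltK be (F a al) -> ltK (p al be) c)) as [c Hc].
    { intros al.
      destruct (bounded_family (seg ltK (F a al)) (fun s => p al (proj1_sig s)))
        as [c Hc].
      - apply le_N_lt_card, segN.
      - exists c. intros be h. exact (Hc (exist _ be h)). }
    destruct (bounded_family _ (fun s => c (proj1_sig s)) small) as [d Hd].
    exists d. intros x [[al [be [-> Hbe]]] Hx].
    assert (Hal : ~ ltK (F a al) (F b al)).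
    { intros H. apply Hx. exists al, be. eauto. }
    apply trans with (c al); [now apply Hc|]. exact (Hd (exist _ al Hal)).
  (* Each remaining column contributes its own code [p al (F a al)]. Were the difference small,
     these columns and the exceptional ones would together put [K] in [J]. *)
  - apply NNPP; intros Hn. apply not_le_lt_card in Hn.
    apply (ideal_proper ltK J Jid).
    apply (ideal_sub ltK J Jid) with (2 := fun al _ => classic (ltK (F a al) (F b al))).
    apply (ideal_setU ltK J Jid).
    2: { apply small_in_ideal, small. }
    apply small_in_ideal. refine (le_lt_card_trans _ _ _ _ Hn).
    assert (Hin : forall s : {al | ltK (F a al) (F b al)},
      setD (fun x => exists al be, x = p al be /\ ltK be (F b al))
           (fun x => exists al be, x = p al be /\ ltK be (F a al))
           (p (proj1_sig s) (F a (proj1_sig s)))).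
    { intros [al h]; simpl. split; [now exists al, (F a al)|].
      intros [al' [be [E Hbe]]]. apply Hp in E as [<- <-]. exact (irr _ Hbe). }
    exists (fun s => exist _ _ (Hin s)). intros s t E.
    apply (f_equal (@proj1_sig _ _)) in E. apply Hp in E as [E _].
    now apply proj1_sig_inj.
Qed.

(** * Guessing sets and their monotonicity *)

Lemma sup_eq_mono (X Y : K -> Prop) (c d : K) :
  (forall x, X x -> ~ Y x -> ltK x c) -> ltK c d ->
  sup_eq ltK X d -> sup_eq ltK Y d.
Proof.
  intros HXY Hc HX g Hg. destruct Kord as [irr [trans [tot _]]].
  (* [m] is the larger of [g] and [c]; points of [X] beyond it lie in [Y]. *)
  assert (Hm : exists m, ltK m d /\ (forall x, ltK m x -> ltK g x /\ ltK c x)).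
  { destruct (tot g c) as [H|[->|H]].
    - exists c. eauto.
    - exists c. auto.
    - exists g. eauto. }
  destruct Hm as [m [Hm Hm']]. destruct (HX m Hm) as [x [Hx Hmx]].
  destruct (Hm' x Hmx) as [Hgx Hcx]. exists x. split; [|exact Hgx].
  apply NNPP; intros Hy. exact (irr c (trans _ _ _ Hcx (HXY x Hx Hy))).
Qed.

Context (B : K -> K -> K -> Prop) (e : K -> K -> N).

(* Indexing by [n : N] instead of [i < d] makes [kappa]-completeness of [J]
   applicable to unions over all indices, although [J] need not be normal. *)
Definition guessed (n : N) (W : K -> Prop) (d : K) : Prop :=
  exists i, ltK i d /\ e d i = n /\ sup_eq ltK (setI W (B d i)) d.

Lemma guessed_mono (n : N) (W W' : K -> Prop) :
  bounded ltK (setD W W') -> bounded ltK (setD (guessed n W) (guessed n W')).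
Proof.
  intros [c Hc]. destruct (succ_card_no_max c) as [c' Hc']. exists c'.
  intros d [[i [Hi [Ei Hs]]] Hn]. apply NNPP; intros Hd. apply Hn.
  exists i. split; [exact Hi|split; [exact Ei|]].
  apply (sup_eq_mono (setI W (B d i)) _ c); [| |exact Hs].
  - intros x [Hx HB] Hx'. apply Hc. split; [exact Hx|]. intros H. now apply Hx'.
  - destruct (lt_total_ge _ _ Hd) as [->|E]; [exact Hc'|].
    destruct Kord as [_ [trans _]]. eauto.
Qed.

(** * Stabilisation and the final contradiction, for tau above kappa *)

Context {T : Type} (ltT : T -> T -> Prop) (Treg : is_regular_cardinal ltT).
Context (TK : ~ le_card T K).
Context (R : T -> K -> Prop)
  (Rmono : forall a b, ltT a b -> bounded ltK (setD (R a) (R b)))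
  (Rfull : forall a b, ltT a b -> le_card K {x | setD (R b) (R a) x}).

Lemma T_bounded_family (I : Type) (F : I -> T) :
  le_card I K -> exists t, forall i, ltT (F i) t.
Proof.
  intros HI. apply (regular_bounded_family ltT Treg). intros H.
  exact (TK (le_card_trans _ _ _ H HI)).
Qed.

Lemma bounded_sub (A A' : K -> Prop) : bounded ltK A' -> subset A A' -> bounded ltK A.
Proof. intros [b Hb] H. exists b. auto. Qed.

Lemma guessed_mono_upper (n : N) (a b c : T) : ltT b c ->
  bounded ltK (setD (guessed n (setD (R b) (R a))) (guessed n (setD (R c) (R a)))).
Proof.
  intros Hbc. apply guessed_mono. apply (bounded_sub _ _ (Rmono b c Hbc)).
  intros x [[Hb Ha] Hn]. split; [exact Hb|]. intros Hc. now apply Hn.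
Qed.

Lemma guessed_mono_lower (n : N) (a b c : T) : ltT a b ->
  bounded ltK (setD (guessed n (setD (R c) (R b))) (guessed n (setD (R c) (R a)))).
Proof.
  intros Hab. apply guessed_mono. apply (bounded_sub _ _ (Rmono a b Hab)).
  intros x [[Hc Hb] Hn]. split; [|exact Hb]. apply NNPP; intros Ha. now apply Hn.
Qed.

(** Each [n] has its own stable index; as there are fewer than tau many [n], one index lies above
    all of them, and moving up to it loses only bounded sets. *)
Lemma stable_upper_index :
  ~ (exists A, ascending_tower J (I_kappa ltK) ltT A) ->
  exists eta : T -> T, forall a, ltT a (eta a) /\
    forall n b, ltT (eta a) b ->
      J (setD (guessed n (setD (R b) (R a))) (guessed n (setD (R (eta a)) (R a)))).
Proof.
  intros Hno. apply functional_choice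
    with (R := fun a h => ltT a h /\ forall n b, ltT h b ->
      J (setD (guessed n (setD (R b) (R a))) (guessed n (setD (R h) (R a))))).
  intros a. pose proof Treg as [[[_ [trans _]] _] _].
  destruct (functional_choice (fun n b0 => forall b, ltT b0 b ->
      J (setD (guessed n (setD (R b) (R a))) (guessed n (setD (R b0) (R a))))))
    as [h Hh].
  { intros n.
    destruct (ascending_or_stable ltK J Jid ltT Treg (fun b => guessed n (setD (R b) (R a))))
      as [H|H]; [|contradiction|exact H].
    intros b c. apply guessed_mono_upper. }
  destruct (T_bounded_family N h (proj1 NK)) as [t Ht].
  destruct (regular_upper_bound ltT Treg a t) as [u [Hau Htu]].
  exists u. split; [exact Hau|]. intros n b Hb.
  assert (Hhu : ltT (h n) u) by eauto.
  apply (ideal_setD_trans ltK J Jid) with (guessed n (setD (R (h n)) (R a))).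
  - apply Hh. eauto.
  - now apply (ideal_bounded ltK J Jid), guessed_mono_upper.
Qed.

(** The sets decrease modulo [J]: for [a] before [b], raise the upper index to a common [c] beyond
    [eta a] and [eta b], lower the bottom index from [b] to [a], then return from [c] to [eta a] by
    stability. *)
Lemma stable_lower_index (eta : T -> T) :
  ~ (exists A, descending_tower J J ltT A) ->
  (forall a, ltT a (eta a) /\ forall n b, ltT (eta a) b ->
      J (setD (guessed n (setD (R b) (R a))) (guessed n (setD (R (eta a)) (R a))))) ->
  exists a, forall n b, ltT a b ->
    J (setD (guessed n (setD (R (eta a)) (R a))) (guessed n (setD (R (eta b)) (R b)))).
Proof.
  intros Hno Heta. pose proof Treg as [[[_ [trans _]] _] _].
  assert (mono : forall n a b, ltT a b ->
    J (setD (guessed n (setD (R (eta b)) (R b))) (guessed n (setD (R (eta a)) (R a))))).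
  { intros n a b Hab.
    destruct (regular_upper_bound ltT Treg (eta a) (eta b)) as [c [Hac Hbc]].
    apply (ideal_setD_trans ltK J Jid) with (guessed n (setD (R c) (R b))).
    { now apply (ideal_bounded ltK J Jid), guessed_mono_upper. }
    apply (ideal_setD_trans ltK J Jid) with (guessed n (setD (R c) (R a))).
    { now apply (ideal_bounded ltK J Jid), guessed_mono_lower. }
    now apply Heta. }
  destruct (functional_choice (fun n a => forall b, ltT a b ->
    J (setD (guessed n (setD (R (eta a)) (R a))) (guessed n (setD (R (eta b)) (R b))))))
    as [h Hh].
  { intros n.
    destruct (descending_or_stable ltK J Jid ltT Treg
                (fun a => guessed n (setD (R (eta a)) (R a)))) as [H|H];
      [|contradiction|exact H].
    apply mono. }
  destruct (T_bounded_family N h (proj1 NK)) as [t Ht].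
  exists t. intros n b Hb.
  apply (ideal_setD_trans ltK J Jid) with (guessed n (setD (R (eta (h n))) (R (h n)))).
  - apply mono, Ht.
  - apply Hh. eauto.
Qed.

(** [N] carries no order, so the recursion runs along [K] and is pulled back by an injection of [N]
    into [K]. *)
Lemma spaced_indices (a1 : T) (eta : T -> T) :
  exists g : N -> T, (forall k, ltT a1 (g k)) /\
    forall k l, k <> l -> ltT (eta (g k)) (g l) \/ ltT (eta (g l)) (g k).
Proof.
  pose proof Treg as [[[_ [trans _]] _] _]. pose proof Kord as [_ [_ [tot wf]]].
  destruct (functional_choice (fun a b => ltT a b /\ ltT a1 b)) as [nx Hnx].
  { intros a. apply (regular_upper_bound ltT Treg). }
  destruct (thin ltK ltT (fun t => eta (nx t))) as [g Hg].
  { exact wf. }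
  { intros x F. apply T_bounded_family.
    exact (le_card_trans _ _ _ (segN x) (proj1 NK)). }
  destruct NK as [[j Hj] _].
  exists (fun k => nx (g (j k))). split; [intros k; apply Hnx|].
  assert (H : forall x y, ltK x y -> ltT (eta (nx (g x))) (nx (g y))).
  { intros x y Hxy. apply trans with (g y); [now apply Hg|apply Hnx]. }
  intros k l Hkl. destruct (tot (j k) (j l)) as [E|[E|E]]; auto.
  now apply Hj in E.
Qed.

Lemma tower_exists
  (Bsmall : forall d i, ltK i d -> lt_card {x | B d i x} (seg ltK d))
  (Bguess : forall W : K -> Prop, le_card K {x | W x} ->
     ~ J (fun d => exists i, ltK i d /\ sup_eq ltK (setI W (B d i)) d))
  (einj : forall d i j, ltK i d -> ltK j d -> e d i = e d j -> i = j) :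
  (exists A, ascending_tower J (I_kappa ltK) ltT A) \/
  (exists A, descending_tower J J ltT A).
Proof.
  apply NNPP; intros Hno.
  destruct stable_upper_index as [eta Heta]; [tauto|].
  destruct (stable_lower_index eta) as [a1 Ha1]; [tauto|exact Heta|].
  destruct (spaced_indices a1 eta) as [g [Hg1 Hg]].
  pose (D := fun a => setD (R (eta a)) (R a)).
  (* For [eta (g k)] below [g l], almost all of [D (g k)] lies in [R (g l)], which [D (g l)] avoids.
     Two uses of [bounded_family] make the bound uniform in [k] and [l]. *)
  assert (Hdisj : exists b, forall k l x, k <> l -> D (g k) x -> D (g l) x -> ltK x b).
  { destruct Kord as [_ [trans _]].
    assert (H : forall k, exists c, forall l x,
      k <> l -> D (g k) x -> D (g l) x -> ltK x c).
    { intros k. assert (H : forall l, exists c, forall x,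
        k <> l -> D (g k) x -> D (g l) x -> ltK x c).
      { intros l. destruct (classic (k = l)) as [E|E].
        - destruct NK as [[j _] _]. exists (j k). tauto.
        - destruct (Hg k l E) as [H|H]; destruct (Rmono _ _ H) as [b Hb]; exists b;
            intros x _ [H1 H2] [H3 H4]; apply Hb; now split. }
      apply functional_choice in H as [h Hh].
      destruct (bounded_family N h NK) as [c Hc]. exists c. eauto. }
    apply functional_choice in H as [h Hh].
    destruct (bounded_family N h NK) as [c Hc]. exists c. eauto. }
  destruct (positive_union N (fun n => guessed n (D a1)) NK) as [n Hn].
  { intros H. apply (Bguess (D a1)).
    - apply Rfull, Heta.
    - apply (ideal_sub ltK J Jid _ _ H). intros d [i [Hi Hs]].
      exists (e d i), i. auto. }
  destruct Hdisj as [b Hb].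
  (* A positive set remains positive after removing [N] many sets of [J] and a bounded set. *)
  assert (Hd : exists d, (forall k, guessed n (D (g k)) d) /\ ltK b d).
  { apply NNPP; intros H. apply Hn. destruct (succ_card_no_max b) as [c Hc].
    apply (ideal_sub ltK J Jid)
      with (setU (fun d => exists k, setD (guessed n (D a1)) (guessed n (D (g k))) d)
                 (fun d => ltK d c)).
    - apply (ideal_setU ltK J Jid).
      + apply Jcomp; [exact NK|]. intros k. apply Ha1, Hg1.
      + apply (ideal_bounded ltK J Jid). now exists c.
    - intros d Hd. apply NNPP; intros H'. apply H. exists d. split.
      + intros k. apply NNPP; intros H''. apply H'. left. exists k. now split.
      + destruct (lt_total_ge d c) as [->|E].
        * intros E. apply H'. now right.
        * exact Hc.
        * destruct Kord as [_ [trans _]]. eauto. }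
  destruct Hd as [d [Hd Hbd]].
  destruct Ninf as [u _].
  (* Injectivity of [e d] makes the index [i] found for one [k] serve for every [k]. *)
  destruct (Hd (u 0)) as [i [Hi [Ei _]]].
  destruct (functional_choice (fun k (s : {x | B d i x}) =>
    D (g k) (proj1_sig s) /\ ltK b (proj1_sig s))) as [s Hs].
  { intros k. destruct (Hd k) as [i' [Hi' [Ei' Hsup]]].
    assert (i' = i) by (apply (einj d); congruence). subst i'.
    destruct (Hsup b Hbd) as [x [[HD HB] Hx]]. now exists (exist _ x HB). }
  (* The points [s k] lie beyond [b], where the sets [D (g k)] are disjoint, so [N] injects into
     [B d i]; but [d] has at most [N] predecessors. *)
  apply (proj2 (Bsmall d i Hi)). apply (le_card_trans _ _ _ (segN d)).
  exists s. intros k l E. apply NNPP; intros Hkl.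
  destruct Kord as [irr [trans _]].
  destruct (Hs k) as [H1 H2]. destruct (Hs l) as [H3 _]. rewrite <- E in H3.
  exact (irr _ (trans _ _ _ H2 (Hb k l _ Hkl H1 H3))).
Qed.

End Successor.

Theorem theorem3p9
  (K : Type) (ltK : K -> K -> Prop)
  (J : (K -> Prop) -> Prop)
  (T : Type) (ltT : T -> T -> Prop) :
  is_successor_cardinal ltK ->
  is_ideal ltK J ->
  kappa_complete J ->
  clubsuit_cof_minus ltK J ->
  is_regular_cardinal ltT ->
  lt_Depth ltK ltT ->
  (exists A : T -> K -> Prop, ascending_tower J (I_kappa ltK) ltT A) \/
  (exists A : T -> K -> Prop, descending_tower J J ltT A).
Proof.
  intros [Kord [N [Ninf [NK segN]]]] Jid Jcomp [B [Bsmall Bguess]] Treg [Tseq _].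
  destruct (classic (le_card T K)) as [TK|TK].
  - left. destruct (ulam ltK J Kord Jid Jcomp N Ninf NK segN) as [V [pos disj]].
    apply (ascending_tower_of_disjoint ltK J Jid ltT Treg V); auto.
    destruct Ninf as [u _], NK as [[j _] _]. now exists (j (u 0)).
  - destruct (almost_increasing_sets ltK J Kord Jid Jcomp N Ninf NK segN ltT Tseq)
      as [R HR].
    destruct (enumerations ltK N Ninf segN) as [e He].
    apply (tower_exists ltK J Kord Jid Jcomp N Ninf NK segN B e ltT Treg TK R).
    + intros a b H. apply HR, H.
    + intros a b H. apply HR, H.
    + intros d i H. apply Bsmall, H.
    + exact Bguess.
    + exact He.
Qed.
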